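(* Let $\mathcal{X}$ be a subset of a Euclidean space $\mathcal{E}$ and $x\in\mathcal{X}$. Consider the statements: (i) $\mathcal{X}$ is Clarke regular at $x$; (ii) $\mathrm{T}_x\mathcal{X}\subseteq\limsup_k\mathrm{T}_{x_k}\mathcal{X}$ for all sequences $(x_k)_{k\geq 1}$ in $\mathcal{X}$ converging to $x$; (iii) $\mathrm{T}_x\mathcal{X}\subseteq\overline{\mathrm{conv}}\left(\limsup_k\mathrm{T}_{x_k}\mathcal{X}\right)$ for all sequences $(x_k)_{k\geq 1}$ in $\mathcal{X}$ converging to $x$; (iv) $x$ is not apocalyptic. Then (i) $\Rightarrow$ (ii) $\Rightarrow$ (iii) $\Leftrightarrow$ (iv).
   Context: Tangent cone: $\mathrm{T}_x\mathcal{X}=\{v=\lim_{k\to\infty}(z_k-x)/\tau_k : z_k\in\mathcal{X},\ \tau_k>0,\ \tau_k\to 0,\text{ the limit exists}\}$. For subsets $C_k\subseteq\mathcal{E}$: $\limsup_k C_k=\{v:\liminf_{k\to\infty}\operatorname{dist}(v,C_k)=0\}$ and $\liminf_k C_k=\{v:\limsup_{k\to\infty}\operatorname{dist}(v,C_k)=0\}$. $\overline{\mathrm{conv}}(A)$ is the closure of the convex hull of $A$. $\mathcal{X}$ is locally closed at $x$ if $\mathcal{X}\cap V$ is closed in $\mathcal{E}$ for some closed neighborhood $V$ of $x$. A locally closed set $\mathcal{X}$ is Clarke regular at $x\in\mathcal{X}$ if $\mathrm{T}_x\mathcal{X}\subseteq\liminf_k\mathrm{T}_{x_k}\mathcal{X}$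 for all sequences $(x_k)_{k\geq1}$ in $\mathcal{X}$ converging to $x$. $\operatorname{Proj}_K(v)$ is any closest point to $v$ in the closed cone $K$. For $f$ continuously differentiable on a neighborhood of $\mathcal{X}$, a point $x\in\mathcal{X}$ is stationary if $\mathrm{D}f(x)[v]\geq0$ for all $v\in\mathrm{T}_x\mathcal{X}$, and $\epsilon$-stationary if $\|\operatorname{Proj}_{\mathrm{T}_x\mathcal{X}}(-\nabla f(x))\|\leq\epsilon$. The point $x$ is apocalyptic if there exist a sequence $(x_k)\subseteq\mathcal{X}$ converging to $x$, a continuously differentiable $f$, and $\epsilon_k>0$ with $\epsilon_k\to0$, such that each $x_k$ is $\epsilon_k$-stationary for $f$ on $\mathcal{X}$ but $x$ is not stationary. *)

(* Defs.v *)
From HB Require Import structures.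
From mathcomp Require Import all_boot all_order all_algebra.
From mathcomp Require Import all_classical all_reals all_analysis.

Set Implicit Arguments.
Unset Strict Implicit.
Unset Printing Implicit Defensive.

Import Order.TTheory GRing.Theory Num.Theory.
Import numFieldNormedType.Exports.

Local Open Scope classical_set_scope.
Local Open Scope ring_scope.

(* [E] is a Euclidean space for the inner product [ip]: [ip] is a symmetric
   positive definite bilinear form, the norm of [E] (hence its metric and
   topology) is the one induced by [ip], and [E] is finite-dimensional. *)
Definition euclidean (R : realType) (E : normedModType R)
    (ip : {dot E for (@idfun R)}) : Prop :=
  (forall v : E, `|v| ^+ 2 = ip v v) /\
  (exists (n : nat) (b : 'I_n -> E),
     forall v : E, exists c : 'I_n -> R, v = \sum_(i < n) c i *: b i).

Section SetLimits.
Context {R : realType} {E : normedModType R}.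

Definition tangent_cone (X : set E) (x : E) : set E :=
  [set v | exists (z : E ^nat) (tau : R ^nat),
     [/\ forall k, X (z k), forall k, 0 < tau k, tau @ \oo --> (0 : R)
       & (fun k => (tau k)^-1 *: (z k - x)) @ \oo --> v]].

(* [edist_inf A v] is dist(v, A), with value +oo when [A] is empty. *)
Definition limsup_set (C : (set E) ^nat) : set E :=
  [set v | limn_einf (fun k => edist_inf (C k) v) = 0%E].

Definition liminf_set (C : (set E) ^nat) : set E :=
  [set v | limn_esup (fun k => edist_inf (C k) v) = 0%E].

Definition closed_conv (A : set E) : set E :=
  closure (smallest (@convex_set R E) A).

Definition locally_closed (X : set E) (x : E) : Prop :=
  exists V : set E, [/\ closed V, nbhs x V & closed (X `&` V)].

Definition Clarke_regular (X : set E) (x : E) : Prop :=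
  locally_closed X x /\
  forall xk : E ^nat, (forall k, X (xk k)) -> xk @ \oo --> x ->
    tangent_cone X x `<=` liminf_set (fun k => tangent_cone X (xk k)).

Definition closest_points (K : set E) (v : E) : set E :=
  [set p | K p /\ forall q, K q -> `|v - p| <= `|v - q|].

End SetLimits.

Section Stationarity.
Context {R : realType} {E : normedModType R}.
Variable ip : {dot E for (@idfun R)}.

(* On a Euclidean space, the Riesz representative of ['d f x]; it exists and
   is unique there whenever [f] is differentiable at [x]. *)
Definition gradient (f : E -> R^o) (x : E) : E :=
  get [set g | forall v : E, 'd f x v = ip g v].

Definition C1_near (X : set E) (f : E -> R^o) : Prop :=
  exists U : set E, [/\ open U, X `<=` U
    & forall y, U y ->
        differentiable f y /\ {for y, continuous (gradient f)}].

Definition stationary (X : set E) (f : E -> R^o) (x : E) : Prop :=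
  forall v, tangent_cone X x v -> 0 <= 'd f x v.

(* In a Euclidean space, a closed cone has closest points to any [v], and they
   all have the same norm, so "some" could equivalently be "every" here. *)
Definition eps_stationary (eps : R) (X : set E) (f : E -> R^o) (x : E) : Prop :=
  exists2 p, closest_points (tangent_cone X x) (- gradient f x) p
           & `|p| <= eps.

Definition apocalyptic (X : set E) (x : E) : Prop :=
  exists (xk : E ^nat) (f : E -> R^o) (eps : R ^nat),
    [/\ [/\ forall k, X (xk k), xk @ \oo --> x & C1_near X f],
        (forall k, 0 < eps k) /\ eps @ \oo --> (0 : R),
        forall k, eps_stationary (eps k) X f (xk k)
      & ~ stationary X f x].

End Stationarity.

(* Main.v *)
Require Import Defs.
From HB Require Import structures.
From mathcomp Require Import all_boot all_order all_algebra.
From mathcomp Require Import all_classical all_reals all_analysis.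
From mathcomp Require Import ring lra.

Import Order.TTheory GRing.Theory Num.Theory.
Import numFieldNormedType.Exports.

Local Open Scope classical_set_scope.
Local Open Scope ring_scope.

(* Idea. The projection [p] of [u] on a closed cone [K] satisfies
   <u, p> = |p|^2 and <u, w> <= |p| |w| for [w] in [K].
   (iii) => (iv): if [x_k] is [eps_k]-stationary for [f], passing to the limit in
   the second relation shows that limsup T_{x_k} X lies in the closed half-space
   <grad f(x), w> >= 0, which then contains T_x X.
   (iv) => (iii): if [v] in T_x X is outside the closed convex hull C of
   limsup T_{x_k} X, then g = v - Proj_C(v) separates [v] from C and the linear
   function f = - <g, .> witnesses that [x] is apocalyptic: a cluster point of
   the projections [p_k] of [g] on T_{x_k} X lies in limsup T_{x_k} X, where
   <g, .> <= 0, while <g, p_k> = |p_k|^2; by compactness p_k -> 0. *)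

(** * Euclidean geometry: Cauchy-Schwarz, frames, Riesz representation, Heine-Borel *)

Section InnerProduct.
Set Implicit Arguments.
Unset Strict Implicit.
Unset Printing Implicit Defensive.

Context {R : realType} {E : normedModType R} (ip : {dot E for (@idfun R)}).
Implicit Types (u v w : E) (a : R).

Lemma ipC u v : ip u v = ip v u.
Proof. by rewrite hermC expr0 mul1r. Qed.

Lemma ipDl u v w : ip (u + v) w = ip u w + ip v w.
Proof. exact: linearDl. Qed.
Lemma ipDr u v w : ip u (v + w) = ip u v + ip u w.
Proof. exact: linearDr. Qed.
Lemma ipNl u v : ip (- u) v = - ip u v.
Proof. exact: linearNl. Qed.
Lemma ipNr u v : ip u (- v) = - ip u v.
Proof. exact: linearNr. Qed.
Lemma ipZl a u v : ip (a *: u) v = a * ip u v.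
Proof. exact: linearZl_LR. Qed.
Lemma ipZr a u v : ip u (a *: v) = a * ip u v.
Proof. by rewrite ipC ipZl ipC. Qed.
Lemma ip_sumr u (s : seq E) (F : E -> E) :
  ip u (\sum_(e <- s) F e) = \sum_(e <- s) ip u (F e).
Proof. exact: linear_sumr. Qed.
Lemma ip0r u : ip u 0 = 0.
Proof. exact: linear0r. Qed.

Hypothesis euclE : euclidean ip.

Lemma ipvv v : ip v v = `|v| ^+ 2.
Proof. by rewrite euclE.1. Qed.

Lemma sqr_normB u v : `|u - v| ^+ 2 = `|u| ^+ 2 - 2 * ip u v + `|v| ^+ 2.
Proof.
by rewrite !euclE.1 !(ipDl, ipDr, ipNl, ipNr) (ipC v u); ring.
Qed.

(** Cauchy-Schwarz: the squared norm of |v| u - |u| v equals 2 |u| |v| (|u| |v| - <u, v>), and the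
    factor |u| |v| cancels. *)
Lemma ip_le_norm u v : ip u v <= `|u| * `|v|.
Proof.
have [->|v0] := eqVneq v 0; first by rewrite ip0r normr0 mulr0.
have v_gt0 : 0 < `|v| by rewrite normr_gt0.
have := sqr_ge0 (`| `|v| *: u - `|u| *: v |).
rewrite sqr_normB !(ipZl, ipZr) !normrZ !normr_id.
have [->|u0] := eqVneq u 0; first by rewrite ipC ip0r normr0 mul0r.
have u_gt0 : 0 < `|u| by rewrite normr_gt0.
move=> h; rewrite -(ler_pM2l (mulr_gt0 u_gt0 v_gt0)); nra.
Qed.

Lemma normr_ip u v : `|ip u v| <= `|u| * `|v|.
Proof.
by rewrite ler_norml ip_le_norm andbT lerNl -ipNl -(normrN u) ip_le_norm.
Qed.

Lemma ip_continuous u : continuous (ip u : E -> R^o).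
Proof.
move=> v; apply/cvgrPdist_le => e e0; near=> w.
rewrite -linearBr (le_trans (normr_ip _ _))//.
have u1 : 0 < `|u| + 1 by rewrite ltr_wpDl.
apply: (@le_trans _ _ ((`|u| + 1) * `|v - w|)); first by rewrite ler_wpM2r// lerDl.
rewrite mulrC -ler_pdivlMr//; near: w.
by apply: cvgr_dist_le; [exact: cvg_id|rewrite divr_gt0].
Unshelve. all: by end_near. Qed.

(** For an orthonormal [t] this is membership in its span, with inner products as coordinates. If it
    holds for every [v], then [t] is a Parseval frame. *)
Definition in_frame (t : seq E) v := v = \sum_(e <- t) ip v e *: e.

Lemma in_frame0 t : in_frame t 0.
Proof. by rewrite /in_frame big1// => e _; rewrite ipC ip0r scale0r. Qed.

Lemma in_frameD t u v a : in_frame t u -> in_frame t v -> in_frame t (a *: u + v).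
Proof.
rewrite /in_frame => hu hv; rewrite {1}hu {1}hv scaler_sumr -big_split/=.
by apply: eq_bigr => e _; rewrite ipDl ipZl scalerDl scalerA.
Qed.

Lemma in_frame_sum t (I : eqType) (s : seq I) (c : I -> R) (F : I -> E) :
  (forall i, i \in s -> in_frame t (F i)) -> in_frame t (\sum_(i <- s) c i *: F i).
Proof.
move=> h; rewrite big_seq; apply: big_ind => [|u w hu hw|i si].
- exact: in_frame0.
- by rewrite -[u]scale1r; exact: in_frameD.
- by rewrite -[_ *: _]addr0; apply: in_frameD; [exact: h|exact: in_frame0].
Qed.

(* One Gram-Schmidt step per spanning vector. Orthogonality of [t] need not be
   tracked: it is enough that [t] reproduces its own members. *)
Lemma frame_exists : exists t : seq E,
  (forall e, e \in t -> `|e| <= 1) /\ forall v, in_frame t v.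
Proof.
have [_ [n [b bP]]] := euclE.
suff [t [t1 _ tb]] : exists t : seq E, [/\ forall e, e \in t -> `|e| <= 1,
    forall e, e \in t -> in_frame t e & forall e, e \in codom b -> in_frame t e].
  exists t; split => // v; have [c ->] := bP v.
  by apply: in_frame_sum => i _; exact/tb/codom_f.
elim: (codom b) => [|x s [t [t1 tt ts]]]; first by exists [::]; split.
(* The residual of [x] is orthogonal to every vector that [t] reproduces ([rt]), so adjoining its
   normalization [e0] preserves the expansions already obtained ([ext]). *)
pose r := x - \sum_(e <- t) ip x e *: e.
have rt v : in_frame t v -> ip v r = 0.
  move=> hv; rewrite /r ipDr ipNr ip_sumr {1}hv ipC ip_sumr; apply/eqP.
  by rewrite subr_eq0; apply/eqP/eq_bigr => e _; rewrite !ipZr mulrC.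
have [r0|r0] := eqVneq r 0.
  exists t; split => // e; rewrite inE => /orP[/eqP->|]; last exact: ts.
  by apply/eqP; rewrite -subr_eq0 -/r r0.
have rn : `|r| != 0 by rewrite normr_eq0.
pose e0 := `|r|^-1 *: r.
have e01 : `|e0| = 1 by rewrite normrZ normfV normr_id mulVf.
have ext v : in_frame t v -> in_frame (e0 :: t) v.
  by move=> hv; rewrite /in_frame big_cons ipZr rt// mulr0 scale0r add0r.
have e0t : \sum_(e <- t) ip e0 e *: e = 0.
  by rewrite big_seq big1// => e et; rewrite ipC ipZr rt ?mulr0 ?scale0r//; exact: tt.
have he0 : in_frame (e0 :: t) e0.
  by rewrite /in_frame big_cons e0t ipvv e01 expr1n scale1r addr0.
exists (e0 :: t); split => e; rewrite inE => /orP[/eqP->|et].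
- by rewrite e01.
- exact: t1.
- exact: he0.
- exact/ext/tt.
- have -> : x = `|r| *: e0 + \sum_(e <- t) ip x e *: e.
    by rewrite scalerA divff// scale1r subrK.
  by apply: in_frameD => //; exact/ext/in_frame_sum.
- exact/ext/ts.
Qed.

(** Applying [L] to the frame expansion of [v] shows that the representative has the coefficients
    [L e]. *)
Lemma riesz (L : {linear E -> R^o}) : exists g, forall v, L v = ip g v.
Proof.
have [t [_ tP]] := frame_exists; exists (\sum_(e <- t) L e *: e) => v.
rewrite {1}(tP v) raddf_sum [RHS]ipC ip_sumr; apply: eq_bigr => e _.
by rewrite ipZr; exact: etrans (linearZ_LR L _ _) (mulrC _ _).
Qed.

(** [get] is meaningful only if a representative exists; Riesz provides one. *)
Lemma gradientP (f : E -> R^o) x v : 'd f x v = ip (gradient ip f x) v.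
Proof.
have [g gP] := riesz ('d f x : {linear E -> R^o}).
by have /(_ v) := @getPex _ [set g | forall v, 'd f x v = ip g v] (ex_intro _ g gP).
Qed.

Lemma gradient_ip g x : gradient ip (ip g : E -> R^o) x = g.
Proof.
have := fun v => gradientP (ip g : E -> R^o) x v.
rewrite diff_lin; last exact: ip_continuous.
move=> h; apply/eqP; rewrite -subr_eq0 -normr_eq0 -sqrf_eq0 -ipvv.
by rewrite {1}ipDl ipNl h subrr.
Qed.

(** Heine-Borel: frame vectors have norm at most 1, so the coefficients of a point of [A] lie in
    [-M, M], and [A] is a closed subset of the continuous image of a compact box. *)
Lemma bounded_closed_compact_euclidean (A : set E) (M : R) :
  (forall v, A v -> `|v| <= M) -> closed A -> compact A.
Proof.
move=> AM cA; have [t [t1 tP]] := frame_exists.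
pose phi (c : 'rV[R]_(size t)) : E := \sum_(i < size t) c ord0 i *: t`_i.
have phic : continuous phi.
  move=> c; apply: (cvg_big (@add_continuous E) (nbhs_filter c)) => i _.
  apply: (@cvgZr_tmp _ _ _ (nbhs c) (nbhs_filter c)).
  exact: coord_continuous.
pose box := [set c : 'rV[R]_(size t) | forall i, `[- M, M]%classic (c ord0 i)].
apply: (@subclosed_compact _ _ (phi @` box)) => //.
  apply: continuous_compact; first exact: continuous_subspaceT.
  exact: (rV_compact (fun=> @segment_compact R (- M) M)).
move=> v Av; exists (\row_i ip v t`_i).
  move=> i /=; rewrite in_itv/= mxE -ler_norml (le_trans (normr_ip _ _))//.
  have ti : `|t`_i| <= 1 by apply/t1/mem_nth.
  by rewrite (le_trans _ (AM _ Av))// ler_piMr.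
rewrite /phi [RHS]tP (big_nth 0) big_mkord.
by apply: eq_bigr => i _; rewrite mxE.
Qed.

End InnerProduct.

(** * Set limits, tangent cones and closed convex hulls, described by epsilons *)

Section ConesAndLimits.
Set Implicit Arguments.
Unset Strict Implicit.
Unset Printing Implicit Defensive.
Context {R : realType} {E : normedModType R}.
Implicit Types (X A : set E) (C : (set E) ^nat) (u v w x : E).

Definition is_cone A := forall a v, 0 < a -> A v -> A (a *: v).

Lemma closedP A :
  closed A <-> forall v, (forall e, 0 < e -> exists2 w, A w & `|v - w| < e) -> A v.
Proof.
split=> [cA v vP|AP v clv]; last first.
  apply: AP => e e0; have [w [Aw vw]] := clv _ (nbhsx_ballx v e e0).
  by exists w => //; rewrite -ball_normE in vw.
apply: cA => B /nbhs_ballP[e /= e0 eB]; have [w Aw vw] := vP e e0.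
by exists w; split => //; apply: eB; rewrite -ball_normE.
Qed.

Lemma limn_einf_edist_infE C v : limn_einf (fun k => edist_inf (C k) v) =
  ereal_sup [set ereal_inf ((fun k => edist_inf (C k) v) @` V) | V in \oo].
Proof. exact: limf_einfE. Qed.

Lemma limn_einf_edist_inf_ge0 C v :
  (0 <= limn_einf (fun k => edist_inf (C k) v))%E.
Proof.
rewrite limn_einf_edist_infE.
apply: (@le_trans _ _ (ereal_inf ((fun k => edist_inf (C k) v) @` setT))).
  by apply: le_ereal_inf_tmp => _ /= [k _ <-]; exact: edist_inf_ge0.
by apply: ereal_sup_ubound; exists setT => //; exact: filterT.
Qed.

(** A zero liminf of distances means distances below [e] at arbitrarily large indices. An empty
    [C k] is at distance +oo and never serves as a witness. *)
Lemma limsup_setP C v : limsup_set C v <->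
  forall e, 0 < e -> forall N, exists k w, [/\ (N <= k)%N, C k w & `|v - w| < e].
Proof.
rewrite /limsup_set /= limn_einf_edist_infE.
split=> [h e e0 N|h].
  (* The infimum over the tail from [N] is bounded by the liminf, which is 0. Being below [e], it
     yields an index, and then the distance at that index yields a point. *)
  have : (ereal_inf ((fun k => edist_inf (C k) v) @` [set k | (N <= k)%N]) < e%:E)%E.
    apply: (@le_lt_trans _ _ 0%E); last by rewrite lte_fin.
    rewrite -h; apply: ereal_sup_ubound; exists [set k | (N <= k)%N] => //.
    exact: nbhs_infty_ge.
  move=> /ereal_inf_lt[_ [k /= Nk <-]] /ereal_inf_lt[_ [w Cw <-]] vw.
  exists k, w; split => //; have := edist_lt_ball vw.
  by rewrite -ball_normE.
apply/eqP; rewrite eq_le; apply/andP; split.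
  apply: ge_ereal_sup => _ [V [N _ NV] <-].
  apply/lee_addgt0Pr => e e0; rewrite add0e.
  have [k [w [Nk Cw vw]]] := h e e0 N.
  apply: ereal_inf_le; exists (edist_inf (C k) v); first by exists k => //; exact: NV.
  apply: ereal_inf_le; exists (edist (v, w)); first by exists w.
  by apply: edist_fin => //=; rewrite -ball_normE.
by rewrite -limn_einf_edist_infE limn_einf_edist_inf_ge0.
Qed.

Lemma sub_liminf_limsup_set C : liminf_set C `<=` limsup_set C.
Proof.
move=> v; rewrite /liminf_set /limsup_set /= => h.
by apply/eqP; rewrite eq_le -{1}h limn_einf_sup limn_einf_edist_inf_ge0.
Qed.

Lemma cone_limsup_set C : (forall k, is_cone (C k)) -> is_cone (limsup_set C).
Proof.
move=> coneC a v a0 /limsup_setP vC; apply/limsup_setP => e e0 N.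
have [k [w [Nk Cw vw]]] := vC (e / a) (divr_gt0 e0 a0) N.
exists k, (a *: w); split => //; first exact: coneC.
by rewrite -scalerBr normrZ gtr0_norm// mulrC -ltr_pdivlMr.
Qed.

(** One [e] controls both the step and the error; the choice e = 1/(k+1) recovers the sequences.
    Closedness then needs no diagonal extraction, only the triangle inequality. *)
Lemma tangent_coneP X x v : tangent_cone X x v <->
  forall e, 0 < e -> exists z t, [/\ X z, 0 < t, t < e & `|v - t^-1 *: (z - x)| < e].
Proof.
split=> [[z [t [Xz t0 tc zc]]] e e0|h].
  have : \forall k \near \oo, t k < e /\ `|v - (t k)^-1 *: (z k - x)| < e.
    near=> k; split; near: k.
      have /cvgrPdist_lt/(_ _ e0) := tc.
      by apply: filterS => k; rewrite sub0r normrN gtr0_norm.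
    by have /cvgrPdist_lt/(_ _ e0) := zc.
  case=> N _ /(_ N (leqnn N)) [tN vN].
  by exists (z N), (t N); split.
have {}h k : exists zt : E * R, [/\ X zt.1, 0 < zt.2, zt.2 < k.+1%:R^-1
    & `|v - zt.2^-1 *: (zt.1 - x)| < k.+1%:R^-1].
  have [|z [t ?]] := h k.+1%:R^-1; first by rewrite invr_gt0.
  by exists (z, t).
have [zt ztP] := choice h.
exists (fst \o zt), (snd \o zt); split => [k|k||].
- by have [] := ztP k.
- by have [] := ztP k.
- apply/cvgrPdist_lt => e e0.
  have := near_infty_natSinv_lt (PosNum e0); apply: filterS => k /= ke.
  have [_ t0 tk _] := ztP k.
  by rewrite sub0r normrN gtr0_norm//; exact: lt_trans ke.
- apply/cvgrPdist_lt => e e0.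
  have := near_infty_natSinv_lt (PosNum e0); apply: filterS => k /= ke.
  by have [_ _ _ vk] := ztP k; exact: lt_trans ke.
Unshelve. all: by end_near. Qed.

Lemma cone_tangent_cone X x : is_cone (tangent_cone X x).
Proof.
move=> a v a0 /tangent_coneP vP; apply/tangent_coneP => e e0.
(* Scaling [v] by [a] turns the step [t] into t/a and multiplies the error by [a]; the two bounds
   compensate for this. *)
have d0 : 0 < Num.min (e * a) (e / a) by rewrite lt_min mulr_gt0 ?divr_gt0.
have [z [t [Xz t0 + +]]] := vP _ d0.
rewrite !lt_min => /andP[te _] /andP[_ vz].
exists z, (t / a); split => //; first by rewrite divr_gt0.
  by rewrite ltr_pdivrMr.
rewrite invfM invrK mulrC -scalerA -scalerBr normrZ gtr0_norm//.
by rewrite mulrC -ltr_pdivlMr.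
Qed.

Lemma closed_tangent_cone X x : closed (tangent_cone X x).
Proof.
apply/closedP => v vP; apply/tangent_coneP => e e0.
have e20 : 0 < e / 2 by rewrite divr_gt0.
have [w /tangent_coneP wT vw] := vP _ e20.
have [z [t [Xz t0 te wz]]] := wT _ e20.
exists z, t; split => //; first by rewrite (lt_trans te)// gtr_pMr// invf_lt1// ltr1n.
by rewrite (splitr e) (le_lt_trans (ler_distD w _ _))// ltrD.
Qed.

Lemma tangent_cone0 X x : X x -> tangent_cone X x 0.
Proof.
move=> Xx; apply/tangent_coneP => e e0; exists x, (e / 2); split => //.
- by rewrite divr_gt0.
- by rewrite gtr_pMr// invf_lt1// ltr1n.
- by rewrite subrr scaler0 subrr normr0.
Qed.

Lemma limsup_set0 C : (forall k, C k 0) -> limsup_set C 0.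
Proof.
by move=> C0; apply/limsup_setP => e e0 N; exists N, 0; rewrite subrr normr0.
Qed.

Lemma sub_closed_conv A : A `<=` closed_conv A.
Proof. by apply: subset_trans (@subset_closure _ _); exact: sub_smallest. Qed.

Lemma closed_conv_min A (H : set E) :
  closed H -> convex_set (H : set (convex_lmodType E)) -> A `<=` H ->
  closed_conv A `<=` H.
Proof.
move=> cH vH AH; move/closure_id: (cH) => ->.
by apply: closureS; exact: smallest_sub.
Qed.

(** The closure of a convex set is convex: approximate both endpoints by points of the hull and
    combine them with the same weights. *)
Lemma closed_conv_segment A u v (t : R) : 0 <= t -> t <= 1 ->
  closed_conv A u -> closed_conv A v -> closed_conv A (t *: u + (1 - t) *: v).
Proof.
move=> t0 t1.
pose p := Itv01 t0 t1.
have hullP a b : smallest (@convex_set R E) A a -> smallest (@convex_set R E) A b ->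
    smallest (@convex_set R E) A (t *: a + (1 - t) *: b).
  move=> ha hb K [Kc AK]; apply/set_mem; apply: (Kc a b p); apply/mem_set.
    exact: ha.
  exact: hb.
rewrite /closed_conv => uA vA B /nbhs_ballP[e /= e0 eB].
have [a [ha ua]] := uA _ (nbhsx_ballx u e e0).
have [b [hb vb]] := vA _ (nbhsx_ballx v e e0).
exists (t *: a + (1 - t) *: b); split; first exact: hullP.
apply: eB; move: ua vb; rewrite -!ball_normE /= => ua vb.
have -> : t *: u + (1 - t) *: v - (t *: a + (1 - t) *: b) =
    t *: (u - a) + (1 - t) *: (v - b).
  by rewrite !scalerBr opprD addrACA.
have s0 : 0 <= 1 - t by rewrite subr_ge0.
rewrite (le_lt_trans (ler_normD _ _))// !normrZ !ger0_norm//.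
(* Bounding both errors by their maximum keeps the inequality strict even when a weight vanishes. *)
have m1 : `|u - a| <= Num.max `|u - a| `|v - b| by rewrite le_max lexx.
have m2 : `|v - b| <= Num.max `|u - a| `|v - b| by rewrite le_max lexx orbT.
have me : Num.max `|u - a| `|v - b| < e by rewrite gt_max ua.
rewrite (le_lt_trans _ me)// (le_trans (lerD (ler_wpM2l t0 m1) (ler_wpM2l s0 m2)))//.
by rewrite -mulrDl addrC subrK mul1r.
Qed.

End ConesAndLimits.

(** * Projections on closed cones, separation, and the equivalence of (iii) and (iv) *)

Section Projections.
Set Implicit Arguments.
Unset Strict Implicit.
Unset Printing Implicit Defensive.
Context {R : realType} {E : normedModType R} (ip : {dot E for (@idfun R)}).
Hypothesis euclE : euclidean ip.
Implicit Types (X A K : set E) (C : (set E) ^nat) (u v w x g p : E).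

Lemma closest_points_exists K v :
  closed K -> K !=set0 -> exists p, closest_points K v p.
Proof.
move=> cK [q0 Kq0].
pose f (q : E) := `|v - q|.
have fc : continuous f.
  by move=> q; apply: cvg_norm; apply: cvgB; [exact: cvg_cst|exact: cvg_id].
(* Only points no farther from [v] than [q0] compete; they form a compact set, where the distance
   attains its minimum. *)
pose B := K `&` [set q | f q <= f q0].
have cB : compact B.
  apply: (@bounded_closed_compact_euclidean _ _ _ euclE _ (`|v| + f q0)).
    by move=> q [_ /= qv]; rewrite -[q](subKr v) (le_trans (ler_normB _ _))// lerD2l.
  apply: closedI => //; apply: (@closed_comp _ _ f [set y | y <= f q0]).
    by move=> q _; exact: fc.
  exact: closed_le.
have B0 : B !=set0 by exists q0; split => //=.
have [p /set_mem[Kp fp] pmin] := compact_EVT_min B0 cB (continuous_subspaceT fc).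
exists p; split => // q Kq.
have [le|/ltW le] := leP (f q) (f q0); last exact: le_trans fp le.
by apply: pmin; apply/mem_set.
Qed.

(** Tangent cones may be nonconvex, so [p] is compared only with points t w of rays. This gives a
    quadratic inequality in t, used at its optimum t = <u, w> / |w|^2. *)
Lemma closest_points_cone K u p : is_cone K -> closest_points K u p ->
  ip u p = `|p| ^+ 2 /\ forall w, K w -> ip u w <= `|p| * `|w|.
Proof.
move=> coneK [Kp pmin].
have key t w : 0 < t -> K w ->
    2 * t * ip u w - t ^+ 2 * `|w| ^+ 2 <= 2 * ip u p - `|p| ^+ 2.
  move=> t0 Kw; have := pmin _ (coneK _ _ t0 Kw).
  rewrite -(@ler_pXn2r _ 2)// ?nnegrE// !(sqr_normB euclE) ipZr normrZ exprMn gtr0_norm//.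
  lra.
have up : ip u p = `|p| ^+ 2.
  have [->|p0] := eqVneq p 0; first by rewrite ip0r normr0 expr0n.
  have P0 : 0 < `|p| ^+ 2 by rewrite exprn_gt0// normr_gt0.
  (* The value t = 1/2 gives <u, p> >= 3/4 |p|^2, so the optimal t on the ray of [p] is positive and
     [key] applies to it. *)
  have h1 := key 2^-1 p ltac:(lra) Kp.
  have b0 : 0 < ip u p by lra.
  have := key (ip u p / `|p| ^+ 2) p (divr_gt0 b0 P0) Kp.
  have -> : 2 * (ip u p / `|p| ^+ 2) * ip u p - (ip u p / `|p| ^+ 2) ^+ 2 * `|p| ^+ 2
      = ip u p ^+ 2 / `|p| ^+ 2.
    by field; rewrite normr_eq0.
  (* The optimum turns [key] into (<u, p> - |p|^2)^2 <= 0. *)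
  rewrite ler_pdivrMr// => h; apply/eqP; rewrite -subr_eq0 -sqrf_eq0.
  by rewrite eq_le sqr_ge0 andbT; nra.
split=> // w Kw; have [le0|uw0] := leP (ip u w) 0.
  by rewrite (le_trans le0)// mulr_ge0.
have w0 : 0 < `|w|.
  by rewrite normr_gt0; apply: contraTneq uw0 => ->; rewrite ip0r ltxx.
have W0 : 0 < `|w| ^+ 2 by rewrite exprn_gt0.
have := key (ip u w / `|w| ^+ 2) w (divr_gt0 uw0 W0) Kw.
have -> : 2 * (ip u w / `|w| ^+ 2) * ip u w - (ip u w / `|w| ^+ 2) ^+ 2 * `|w| ^+ 2
    = ip u w ^+ 2 / `|w| ^+ 2.
  by field; rewrite normr_eq0 -normr_gt0.
rewrite up ler_pdivrMr// => h.
rewrite -(@ler_pXn2r _ 2)// ?nnegrE ?mulr_ge0// ?(ltW uw0)// exprMn.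
lra.
Qed.

(** Variational inequality: otherwise a small move from [q] towards [w] would bring the point closer
    to [v]. *)
Lemma closest_points_segment K v q w :
  closest_points K v q ->
  (forall t : R, 0 <= t -> t <= 1 -> K (t *: w + (1 - t) *: q)) ->
  ip (v - q) (w - q) <= 0.
Proof.
move=> [Kq qmin] segK; apply: contrapT => /negP; rewrite -ltNge => d0.
have key t : 0 < t -> t <= 1 -> 2 * ip (v - q) (w - q) <= t * `|w - q| ^+ 2.
  move=> t0 t1.
  have : `|v - q| ^+ 2 <= `|(v - q) - t *: (w - q)| ^+ 2.
    rewrite ler_pXn2r ?nnegrE//.
    have -> : v - q - t *: (w - q) = v - (t *: w + (1 - t) *: q).
      by rewrite scalerBl scale1r scalerBr !opprD !opprK !addrA (addrAC v).
    exact: qmin _ (segK _ (ltW t0) t1).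
  rewrite (sqr_normB euclE (v - q) (t *: _)) ipZr normrZ exprMn gtr0_norm//.
  move=> h; rewrite -(ler_pM2l t0); lra.
have W0 := sqr_ge0 `|w - q|.
have h1 := key 1 ltr01 (lexx _).
have W1 : 0 < `|w - q| ^+ 2 by lra.
(* With d the inner product, t = d / |w - q|^2 is at most 1 by [h1], and [key] becomes 2 d <= d,
   contradicting d > 0. *)
have := key (ip (v - q) (w - q) / `|w - q| ^+ 2) (divr_gt0 d0 W1).
rewrite ler_pdivrMr// mul1r divfK ?gt_eqF//; lra.
Qed.

Lemma cone_separation A v : is_cone A -> A 0 -> ~ closed_conv A v ->
  exists g, (forall w, A w -> ip g w <= 0) /\ 0 < ip g v.
Proof.
move=> coneA A0 Av.
have [q qP] := closest_points_exists v (@closed_closure _ _)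
  (ex_intro _ 0 (sub_closed_conv A0) : closed_conv A !=set0).
have Cq : closed_conv A q by case: qP.
have var w : A w -> ip (v - q) w <= ip (v - q) q.
  move=> Aw; rewrite -subr_le0 -ipNr -ipDr.
  apply: (closest_points_segment qP) => t t0 t1.
  exact: closed_conv_segment (sub_closed_conv Aw) Cq.
exists (v - q); split=> [w Aw|].
  have [//|g0] := leP (ip (v - q) w) 0.
  have q1 : 0 < ip (v - q) q + 1 by rewrite (lt_le_trans g0)// (le_trans (var _ Aw))// lerDl.
  (* If <g, w> > 0, rescaling [w] makes the inner product equal to <g, q> + 1, above the bound
     [var]. *)
  have := var _ (coneA _ _ (divr_gt0 q1 g0) Aw).
  by rewrite ipZr divfK ?gt_eqF//; lra.
(* The point 0 of [A] gives <g, q> >= 0, hence <g, v> = |g|^2 + <g, q> > 0. *)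
have := var _ A0; rewrite ip0r => q0.
have vq : 0 < ip (v - q) (v - q).
  rewrite (ipvv euclE) exprn_gt0// normr_gt0 subr_eq0.
  by apply: contra_not_neq Av => ->.
move: vq; rewrite [X in 0 < X]ipDr ipNr; lra.
Qed.

Lemma closed_conv_halfspace A g : (forall w, A w -> ip g w <= 0) ->
  forall v, closed_conv A v -> ip g v <= 0.
Proof.
move=> Ag; apply: (@closed_conv_min _ _ _ [set v | ip g v <= 0]) => //.
  apply: (@closed_comp _ _ (ip g : E -> R^o) [set y : R | y <= 0]).
    by move=> v _; exact: ip_continuous.
  exact: closed_le.
move=> u v l /set_mem /= ug /set_mem /= vg; apply/mem_set => /=.
rewrite /conv/= ipDr !ipZr.
have l0 : 0 <= l%:num by [].
have l1 : l%:num <= 1 by [].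
by rewrite /unstable.onem; nra.
Qed.

Lemma gradient_limsup_ge0 X x (xk : E ^nat) (f : E -> R^o) (eps : R ^nat) w :
  gradient ip f y @[y --> x] --> gradient ip f x ->
  xk @ \oo --> x -> eps @ \oo --> (0 : R) ->
  (forall k, eps_stationary ip (eps k) X f (xk k)) ->
  limsup_set (fun k => tangent_cone X (xk k)) w ->
  0 <= ip (gradient ip f x) w.
Proof.
move=> gc xkx eps0 st /limsup_setP wP.
set G := gradient ip f x.
apply: contrapT => /negP; rewrite -ltNge => Gw.
(* The three errors in [eqG] are at most d (|w| + 1), d (|w| + 1) and d |G|. Their sum stays below d
   M thanks to the extra 1 in [M], whereas d M <= - <G, w>. *)
pose M := 2 * `|w| + 3 + `|G|.
have M0 : 0 < M.
  by rewrite /M; have := normr_ge0 w; have := normr_ge0 G; lra.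
pose d := Num.min 1 (- ip G w / M).
have d0 : 0 < d by rewrite lt_min ltr01 divr_gt0// oppr_gt0.
have gk : gradient ip f (xk k) @[k --> \oo] --> G by apply: cvg_comp xkx gc.
have [N _ NP] : \forall k \near \oo,
    `|eps k| < d /\ `|G - gradient ip f (xk k)| < d.
  near=> k; split; near: k.
    by have /cvgrPdist_lt/(_ _ d0) := eps0; apply: filterS => k; rewrite sub0r normrN.
  by have /cvgrPdist_lt/(_ _ d0) := gk.
have [k [wk [Nk Twk wwk]]] := wP _ d0 N.
have [ed Gd] := NP k Nk.
have [p pP pe] := st k.
have [_ /(_ _ Twk)] := closest_points_cone (@cone_tangent_cone _ _ X (xk k)) pP.
set Gk := gradient ip f (xk k) in Gd *; rewrite ipNl => hk.
have d1 : d <= 1 by rewrite ge_min lexx.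
have wk1 : `|wk| <= `|w| + 1.
  rewrite -[wk](subKr w) (le_trans (ler_normB _ _))// lerD2l.
  exact: le_trans (ltW wwk) d1.
have pd : `|p| <= d by rewrite (le_trans pe)// (le_trans (ler_norm _))// ltW.
have h1 : `|p| * `|wk| <= d * (`|w| + 1) by rewrite ler_pM.
have h2 : - ip (G - Gk) wk <= d * (`|w| + 1).
  rewrite -ipNl (le_trans (ip_le_norm euclE _ _))// normrN ler_pM//; exact: ltW.
have h3 : - ip G (w - wk) <= `|G| * d.
  by rewrite -ipNr (le_trans (ip_le_norm euclE _ _))// normrN ler_wpM2l// ltW.
have dM : d * M <= - ip G w by rewrite -ler_pdivlMr// ge_min lexx orbT.
have eqG : - ip G w = - ip Gk wk + - ip (G - Gk) wk + - ip G (w - wk).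
  by rewrite !(ipDl, ipDr, ipNl, ipNr); ring.
move: dM; rewrite /M; nra.
Unshelve. all: by end_near. Qed.

Lemma closest_points_cvg0 C g (p : E ^nat) : (forall k, is_cone (C k)) ->
  (forall k, closest_points (C k) g (p k)) ->
  (forall w, limsup_set C w -> ip g w <= 0) -> p @ \oo --> (0 : E).
Proof.
move=> coneC pP gC; apply/cvgrPdist_lt => e e0; apply: contrapT => nearN.
(* The indices [k N] may repeat: N <= k N is enough for cluster points of [p \o k] to lie in the
   limsup. *)
have /choice[k kP] : forall N : nat, exists m, (N <= m)%N /\ e <= `|p m|.
  move=> N; apply: contrapT => hN; apply: nearN.
  exists N => // m /= Nm; rewrite sub0r normrN ltNge; apply/negP => em.
  by apply: hN; exists m.
have gp N : ip g (p N) = `|p N| ^+ 2 by have [] := closest_points_cone (coneC N) (pP N).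
(* |p|^2 = <g, p> <= |g| |p|, so the projections stay in a compact ball. *)
have pg N : `|p N| <= `|g|.
  have [->|p0] := eqVneq (p N) 0; first by rewrite normr0.
  have p_gt0 : 0 < `|p N| by rewrite normr_gt0.
  by rewrite -(ler_pM2r p_gt0) -expr2 -gp ip_le_norm.
have cptB : compact [set v : E | `|v| <= `|g|].
  apply: (@bounded_closed_compact_euclidean _ _ _ euclE _ `|g|) => //.
  apply: (@closed_comp _ _ (fun v : E => `|v|) [set y | y <= `|g|]).
    by move=> v _; exact: norm_continuous.
  exact: closed_le.
have [|q [_ qcl]] := cptB ((p \o k) @ \oo) _.
  by exists 0 => // N _ /=.
have gq : ip g q <= 0.
  apply/gC/limsup_setP => d d0 N.
  have [|y [[m [Nm <-]] qy]] := qcl [set y | exists m, (N <= m)%N /\ p (k m) = y]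
      _ _ (nbhsx_ballx q d d0).
    by exists N => // m /= Nm; exists m.
  exists (k m), (p (k m)); split.
  - exact: leq_trans Nm (kP m).1.
  - by have [] := pP (k m).
  - by rewrite -ball_normE in qy.
(* This closed half-space contains every [p (k N)], since <g, p> = |p|^2 >= e^2, and therefore
   contains the cluster point [q]. *)
have : e ^+ 2 <= ip g q.
  have cH : closed [set v | e ^+ 2 <= ip g v].
    apply: (@closed_comp _ _ (ip g : E -> R^o) [set y : R | e ^+ 2 <= y]).
      by move=> v _; exact: ip_continuous.
    exact: closed_ge.
  apply: cH => B; apply: qcl; exists 0 => // N _ /=.
  by rewrite gp ler_pXn2r ?nnegrE ?(ltW e0)// (kP N).2.
by rewrite leNgt (le_lt_trans gq)// exprn_gt0.
Qed.

Lemma not_apocalypticP X x : X x ->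
  (forall xk : E ^nat, (forall k, X (xk k)) -> xk @ \oo --> x ->
    tangent_cone X x
      `<=` closed_conv (limsup_set (fun k => tangent_cone X (xk k)))) <->
  ~ apocalyptic ip X x.
Proof.
move=> Xx; split=> [sub [xk [f [eps [[Xk xkx [U [oU XU UP]]] [_ eps0] st]]]]|napo].
  apply => v /(sub _ Xk xkx) vC; rewrite (gradientP euclE).
  have [_ gc] := UP x (XU _ Xx).
  rewrite -oppr_le0 -ipNl; apply: closed_conv_halfspace vC => w wC.
  by rewrite ipNl oppr_le0; exact: (gradient_limsup_ge0 gc xkx eps0 st wC).
move=> xk Xk xkx v vT; apply: contrapT => vC.
pose T k := tangent_cone X (xk k).
have coneT k : is_cone (T k) by exact: cone_tangent_cone.
have T0 k : T k 0 by exact: tangent_cone0.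
have [g [gT gv]] := cone_separation (cone_limsup_set coneT) (limsup_set0 T0) vC.
have /choice[p pP] : forall k, exists p, closest_points (T k) g p.
  move=> k; apply: closest_points_exists; first exact: closed_tangent_cone.
  by exists 0.
have p0 := closest_points_cvg0 coneT pP gT.
(* The negative gradient of this linear function is [g] everywhere. The term 1/(k+1) keeps the
   tolerance positive when [p k] is 0. *)
apply: napo; exists xk, (ip (- g)), (fun k => `|p k| + k.+1%:R^-1); split.
- split => //; exists setT; split => //; first exact: openT.
  move=> y _; split.
    by apply: linear_differentiable; exact: ip_continuous.
  have -> : gradient ip (ip (- g) : E -> R^o) = cst (- g).
    by apply/funext => z; exact: gradient_ip.
  exact: cst_continuous.
- split=> [k|]; first by rewrite ltr_wpDl// invr_gt0.
  rewrite -(addr0 (0 : R)); apply: cvgD; last exact: cvg_harmonic.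
  by rewrite -(normr0 E); exact: cvg_norm.
- move=> k; exists (p k); last by rewrite lerDl invr_ge0.
  by rewrite gradient_ip// opprK; exact: pP.
- move=> /(_ v vT); rewrite (gradientP euclE) gradient_ip// ipNl oppr_ge0.
  by rewrite leNgt gv.
Qed.

End Projections.

Theorem corollary2p15 (R : realType) (E : normedModType R)
    (ip : {dot E for (@idfun R)}) (euclE : euclidean ip)
    (X : set E) (x : E) (Xx : X x) :
  let ii := forall xk : E ^nat, (forall k, X (xk k)) -> xk @ \oo --> x ->
    tangent_cone X x `<=` limsup_set (fun k => tangent_cone X (xk k)) in
  let iii := forall xk : E ^nat, (forall k, X (xk k)) -> xk @ \oo --> x ->
    tangent_cone X x
      `<=` closed_conv (limsup_set (fun k => tangent_cone X (xk k))) in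
  let iv := ~ apocalyptic ip X x in
  [/\ Clarke_regular X x -> ii, ii -> iii & iii <-> iv].
Proof.
move=> ii iii iv; split=> [[_ reg]|hii|].
- move=> xk Xk xkx; apply: subset_trans (reg _ Xk xkx) _.
  exact: sub_liminf_limsup_set.
- move=> xk Xk xkx; apply: subset_trans (hii _ Xk xkx) _.
  exact: sub_closed_conv.
- exact: not_apocalypticP.
Qed.
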